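(* Let $L$ be a positive integer, $N=2^L$, let $m\ge2$ and $n\ge0$ be integers with $m+n\le N$, let $a_{-n},\dots,a_{m-1}\in\mathbb{C}$ with $a_{m-1}\ne0$, $a_{-n}\neq0$, and let $A=\mathsf{circ}(a_0,\dots,a_{m-1},0,\dots,0,a_{-n},\dots,a_{-1})\in\mathbb{C}^{2^L\times 2^L}$. Assume that the polynomial $g(z)=\sum_{k=-n}^{m-1}a_kz^{k+n}$ has no roots on the unit circle $\{z\in\mathbb{C}:|z|=1\}$ (under this condition $A$ is invertible). Then the QTT ranks of $A^{-1}$ do not exceed $m+n$.
   Context: Rows and columns of $N\times N$ matrices are indexed by $0,\dots,N-1$. $\mathsf{circ}(c_0,\dots,c_{N-1})$ is the circulant matrix with entries $c_{(i-j)\bmod N}$; in $\mathsf{circ}(a_0,\dots,a_{m-1},0,\dots,0,a_{-n},\dots,a_{-1})$ we have $c_k=a_k$ for $0\le k\le m-1$, $c_{N+k}=a_k$ for $-n\le k\le-1$, and $c_k=0$ otherwise. QTT representation and QTT ranks: for $i_1,\dots,i_L\in\{0,1\}$ write $\overline{i_L\dots i_1}=\sum_{k=1}^L2^{L-k}i_k$. A QTT representation of $B\in\mathbb{C}^{2^L\times2^L}$ with ranks $(r_1,\dots,r_{L-1})$ is a family of core tensors $G^{(1)},\dots,G^{(L)}$ with $$B_{\overline{i_L\dots i_1},\overline{j_L\dots j_1}}=\sum_{\alpha_1=1}^{r_1}\cdots\sum_{\alpha_{L-1}=1}^{r_{L-1}}G^{(1)}_{i_1j_1\alpha_1}G^{(2)}_{\alpha_1i_2j_2\alpha_2}\cdots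 G^{(L-1)}_{\alpha_{L-2}i_{L-1}j_{L-1}\alpha_{L-1}}G^{(L)}_{\alpha_{L-1}i_Lj_L}$$ for all binary indices. The QTT ranks of $B$ are the minimal possible $r_1,\dots,r_{L-1}$; the $k$-th one equals the matrix rank of the $2^{2k}\times2^{2(L-k)}$ unfolding matrix whose rows are indexed by $(i_1,j_1,\dots,i_k,j_k)$, whose columns are indexed by $(i_{k+1},j_{k+1},\dots,i_L,j_L)$, and whose entries are $B_{\overline{i_L\dots i_1},\overline{j_L\dots j_1}}$. *)

(* Defs.v *)
From HB Require Import structures.
From mathcomp Require Import all_boot all_order all_algebra.
From mathcomp Require Import reals complex.

Set Implicit Arguments.
Unset Strict Implicit.
Unset Printing Implicit Defensive.

Import Order.TTheory GRing.Theory Num.Theory.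
Local Open Scope ring_scope.

(* Only c 0, ..., c (N - 1) matter; the subscript is (i - j) mod N, and the
   truncated subtraction N - j is exact since j < N. *)
Definition circ (C : Type) (N : nat) (c : nat -> C) : 'M[C]_N :=
  \matrix_(i < N, j < N) c ((i + (N - j)) %% N)%N.

(* First column of circ(a_0, ..., a_(m-1), 0, ..., 0, a_(-n), ..., a_(-1)). *)
Definition band_seq (C : nmodType) (N m n : nat) (a : int -> C) (k : nat) : C :=
  if (k < m)%N then a k%:Z
  else if (N - n <= k)%N then a (k%:Z - N%:Z)
  else 0.

Definition band_poly (C : nzRingType) (m n : nat) (a : int -> C) : {poly C} :=
  \poly_(l < m + n) a (l%:Z - n%:Z).

Lemma bits_index_subproof (L : nat) (b : 'I_L -> 'I_2) :
  (\sum_(k < L) 2 ^ (L - k.+1) * b k < 2 ^ L)%N.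
Proof.
elim: L b => [|L IHL] b; first by rewrite big_ord0.
rewrite big_ord_recl expnS mul2n -addnn subSS subn0.
have le_b : (2 ^ L * b ord0 <= 2 ^ L)%N.
  by rewrite -{2}[(2 ^ L)%N]muln1 leq_mul2l -ltnS ltn_ord orbT.
rewrite -addnS leq_add //.
Qed.

(* Bits are numbered from 0, so b k stands for i_(k+1); the first bit is the
   most significant one. *)
Definition bits_index (L : nat) (b : 'I_L -> 'I_2) : 'I_(2 ^ L) :=
  Ordinal (bits_index_subproof b).

(* The ranks r_1, ..., r_(L-1) completed by r_0 = r_L = 1: the first and the
   last core tensors have a dummy outer index ranging over a singleton. *)
Definition qtt_dim (r : seq nat) (k : nat) : nat := nth 1%N (1%N :: r) k.

Definition qtt_cores (C : Type) (L : nat) (r : L.-1.-tuple nat) : Type :=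
  forall k : 'I_L,
    'I_(qtt_dim r k) -> 'I_2 -> 'I_2 -> 'I_(qtt_dim r k.+1) -> C.

Definition is_qtt_repr (C : nzRingType) (L : nat) (B : 'M[C]_(2 ^ L))
    (r : L.-1.-tuple nat) (G : qtt_cores C r) : Prop :=
  forall i j : 'I_L -> 'I_2,
    B (bits_index i) (bits_index j) =
    \sum_(alpha : {dffun forall k : 'I_L.+1, 'I_(qtt_dim r k)})
      \prod_(k < L) G k (alpha (widen_ord (leqnSn L) k)) (i k) (j k)
                        (alpha (lift ord0 k)).

Definition has_qtt_repr (C : nzRingType) (L : nat) (B : 'M[C]_(2 ^ L))
    (r : L.-1.-tuple nat) : Prop :=
  exists G : qtt_cores C r, is_qtt_repr B G.

(* r is the (necessarily unique) componentwise least tuple of ranks. *)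
Definition is_qtt_ranks (C : nzRingType) (L : nat) (B : 'M[C]_(2 ^ L))
    (r : L.-1.-tuple nat) : Prop :=
  has_qtt_repr B r /\
  forall r' : L.-1.-tuple nat, has_qtt_repr B r' ->
    forall k : 'I_L.-1, (tnth r k <= tnth r' k)%N.

(* Main.v *)
(* At an N-th root of unity z, N = 2^L, the symbol of A equals z^(-n) g(z), so
   the Vandermonde matrix of the N-th roots of unity shows that A is invertible.
   The inverse is a circulant circ(c) whose entries satisfy, cyclically, the
   recurrence of order m + n - 1 with the coefficients of g, except at one
   position.  With M = 2^(L-k), the k-th unfolding of circ(c) has, up to
   repetitions, the rows c_(Md+e), -M < e < M, one for each cyclic difference d
   of the high parts of the row and column indices.  For d <> 0 the exceptional
   position is avoided, so the row is a fixed linear function of its first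
   m + n - 1 entries; the row d = 0 adds at most one to the rank. *)

Require Import Defs.
From mathcomp Require Import all_boot all_order all_algebra.
From mathcomp Require Import reals complex.
From mathcomp Require Import separable cyclotomic zify.

Set Implicit Arguments.
Unset Strict Implicit.
Unset Printing Implicit Defensive.

Import Order.TTheory GRing.Theory Num.Theory.
Local Open Scope ring_scope.
Local Open Scope complex_scope.

(** * Inverses of circulant matrices *)

(** The cyclic difference p - k is written with the truncated [N - k]; to identify it with [y] it
    suffices to check [y + k] against [p] modulo [N]. *)
Lemma modn_addB N p k y : (k <= N)%N -> y + k = p %[mod N] ->
  ((p + (N - k)) %% N = y %% N)%N.
Proof.
by move=> le_kN eq_p; rewrite -modnDml -eq_p modnDml -addnA subnKC // modnDr.
Qed.

Lemma sum_ord_shift (V : nmodType) N (f : nat -> V) s :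
  \sum_(l < N) f ((l + s) %% N)%N = \sum_(l < N) f l.
Proof.
case: N => [|N]; first by rewrite !big_ord0.
pose h (l : 'I_N.+1) := Ordinal (ltn_pmod (l + s) (ltn0Sn N)).
rewrite [RHS](@reindex_inj _ _ _ _ h) // => i j /(congr1 val) /eqP /=.
by rewrite eqn_modDr !modn_small // => /eqP /val_inj.
Qed.

Lemma sum_ord_reflect (V : nmodType) N (f : nat -> V) s :
  \sum_(l < N) f ((s + (N - l)) %% N)%N = \sum_(l < N) f l.
Proof.
rewrite -(sum_ord_shift N f s.+1) (reindex_inj rev_ord_inj).
by apply: eq_bigr => l _ /=; rewrite subKn // addnC addSnnS.
Qed.

Lemma circ_mul (F : comNzRingType) N (b c : nat -> F) :
  circ N b *m circ N c =
  circ N (fun p => \sum_(l < N) b ((p + (N - l)) %% N)%N * c l).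
Proof.
apply/matrixP => i j; rewrite !mxE; set p := ((i + (N - j)) %% N)%N.
rewrite -(sum_ord_shift N (fun l => b ((p + (N - l)) %% N)%N * c l) (N - j)).
apply: eq_bigr => l _; rewrite !mxE /p; congr (b _ * _).
have N_gt0 : (0 < N)%N := leq_ltn_trans (leq0n i) (ltn_ord i).
apply/esym/modn_addB; first by rewrite ltnW // ltn_mod.
rewrite modnDmr modn_mod -[RHS]modnDr.
by congr (_ %% _)%N; have := ltn_ord l; lia.
Qed.

Lemma circ_delta (F : nzRingType) N :
  circ N (fun k => (k == 0%N)%:R) = 1%:M :> 'M[F]_N.
Proof.
apply/matrixP => i j; rewrite !mxE; congr (_%:R).
have lt_iN := ltn_ord i; have lt_jN := ltn_ord j.
rewrite -val_eqE /=; have [le_ji|lt_ij] := leqP j i.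
  have -> : (i + (N - j) = i - j + N)%N by lia.
  by rewrite modnDr modn_small; lia.
by rewrite modn_small; lia.
Qed.

Lemma invmx_circ (F : comUnitRingType) N (b : nat -> F) :
  (0 < N)%N -> circ N b \in unitmx ->
  exists2 c : nat -> F, invmx (circ N b) = circ N c &
    forall p, \sum_(l < N) b ((p + (N - l)) %% N)%N * c l = (p %% N == 0)%N%:R.
Proof.
move=> N_gt0 uB; pose o := Ordinal N_gt0.
(* The candidate first column is column 0 of the inverse; uniqueness of the inverse then forces the
   whole matrix to be [circ N c]. *)
pose c k := invmx (circ N b) (Ordinal (ltn_pmod k N_gt0)) o.
have cE p : \sum_(l < N) b ((p + (N - l)) %% N)%N * c l = (p %% N == 0)%N%:R.
  have /matrixP/(_ (Ordinal (ltn_pmod p N_gt0)) o) := mulmxV uB.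
  rewrite !mxE => <-; apply: eq_bigr => l _; rewrite mxE /= modnDml.
  by congr (_ * invmx _ _ _); apply: val_inj; rewrite /= modn_small.
exists c => //; apply: (can_inj (mulKmx uB)); rewrite mulmxV // circ_mul.
rewrite -circ_delta; apply/matrixP => i j; rewrite !mxE cE.
by rewrite modn_mod.
Qed.

(** Each column of powers of a root of unity is an eigenvector. Transposing makes the eigenvalue the
    symbol at z instead of at 1/z. *)
Lemma circ_mul_Vandermonde (F : comNzRingType) N (b : nat -> F) (z : 'rV[F]_N) :
  (forall k, z 0 k ^+ N = 1) ->
  (circ N b)^T *m Vandermonde N z =
  Vandermonde N z *m diag_mx (\row_k \sum_(l < N) b l * z 0 k ^+ l).
Proof.
move=> zN1; apply/matrixP => j k; rewrite mul_mx_diag !mxE mulr_sumr.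
rewrite -(sum_ord_shift N (fun l => z 0 k ^+ j * (b l * z 0 k ^+ l)) (N - j)).
apply: eq_bigr => i _; rewrite !mxE mulrCA; congr (_ * _).
rewrite (expr_mod _ (zN1 k)) -exprD addnCA subnKC 1?ltnW //.
by rewrite exprD zN1 mulr1.
Qed.

Lemma roots_of_unity_exist (F : closedFieldType) N : N%:R != 0 :> F ->
  exists2 z : 'rV[F]_N, forall k, z 0 k ^+ N = 1 & injective (z 0).
Proof.
move=> Nn0; have N_gt0 : (0 < N)%N by case: N Nn0 => //; rewrite eqxx.
have [r] := closed_field_poly_normal ('X^N - 1 : {poly F}).
rewrite lead_coefXnsubC // scale1r => rE.
have r_uniq : uniq r.
  by rewrite -separable_prod_XsubC -rE separable_Xn_sub_1.
have sz_r : size r = N.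
  by apply: succn_inj; rewrite -(size_prod_XsubC r id) -rE size_XnsubC.
exists (\row_k r`_k) => [k|k l]; rewrite !mxE.
  have: root ('X^N - 1) r`_k by rewrite rE root_prod_XsubC mem_nth ?sz_r.
  by rewrite rootE !hornerE subr_eq0 => /eqP.
by move/eqP; rewrite nth_uniq ?sz_r // => /eqP/val_inj.
Qed.

Lemma circ_unitmx (F : closedFieldType) N (b : nat -> F) : N%:R != 0 :> F ->
  (forall z, z ^+ N = 1 -> \sum_(l < N) b l * z ^+ l != 0) ->
  circ N b \in unitmx.
Proof.
move=> Nn0 bn0; have [z zN1 z_inj] := roots_of_unity_exist Nn0.
have /(congr1 determinant) := circ_mul_Vandermonde b zN1.
rewrite !det_mulmx det_tr [RHS]mulrC => /mulIf eq_det.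
rewrite unitmxE unitfE eq_det ?det_diag.
  by apply/prodf_neq0 => k _; rewrite mxE bn0.
rewrite det_Vandermonde; apply/prodf_neq0 => i _; apply/prodf_neq0 => j lt_ij.
by rewrite subr_eq0; apply/eqP => /z_inj eq_ij; rewrite eq_ij ltnn in lt_ij.
Qed.

(** * Banded circulants: symbol and recurrence *)

Section Band.
Variables (F : comNzRingType) (N m n : nat) (a : int -> F).
Hypothesis le_mnN : (m + n <= N)%N.

(** Rotating by n places moves the wrapped entries a_(-n), ..., a_(-1) to the front, so the band
    becomes the coefficient list of g; [le_mnN] keeps its two ends from overlapping. *)
Lemma band_seq_shift l : (l < N)%N ->
  band_seq N m n a ((l + (N - n)) %% N)%N =
  if (l < m + n)%N then a (l%:Z - n%:Z) else 0.
Proof.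
move=> lt_lN; rewrite /band_seq; have [lt_ln|le_nl] := ltnP l n.
  rewrite modn_small; last lia.
  rewrite ifF; last lia.
  rewrite ifT; last lia.
  rewrite ifT; last lia.
  by congr a; lia.
have -> : (l + (N - n) = l - n + N)%N by lia.
rewrite modnDr modn_small; last lia.
rewrite ltn_subLR // addnC; case: ifP => lt_lmn; first by congr a; lia.
by rewrite ifF //; lia.
Qed.

Lemma sum_band_seq (f : nat -> F) :
  \sum_(k < N) band_seq N m n a k * f k =
  \sum_(l < m + n) a (l%:Z - n%:Z) * f ((l + (N - n)) %% N)%N.
Proof.
rewrite -(sum_ord_shift N (fun k => _ k * f k) (N - n)).
pose g l := a (l%:Z - n%:Z) * f ((l + (N - n)) %% N)%N.
rewrite (big_ord_widen N g) // [RHS]big_mkcond.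
apply: eq_bigr => l _; rewrite band_seq_shift //.
by case: ifP => // _; rewrite mul0r.
Qed.

Lemma horner_band_seq z : z ^+ N = 1 ->
  \sum_(k < N) band_seq N m n a k * z ^+ k =
  (band_poly m n a).[z] * z ^+ (N - n).
Proof.
move=> zN1; rewrite sum_band_seq horner_poly mulr_suml.
by apply: eq_bigr => l _; rewrite expr_mod // exprD mulrA.
Qed.

(** This is the convolution identity at position u - n: reflecting the summation index moves the
    shift from the band onto [c]. *)
Lemma band_recurrence (c : nat -> F) : (0 < N)%N ->
  (forall p, \sum_(l < N) band_seq N m n a ((p + (N - l)) %% N)%N * c l =
             (p %% N == 0)%N%:R) ->
  forall u, \sum_(l < m + n) a (l%:Z - n%:Z) * c ((u + (N - l)) %% N)%N =
            ((u + (N - n)) %% N == 0)%N%:R.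
Proof.
move=> N_gt0 cE u; rewrite -cE; set p := (u + (N - n))%N.
pose b k := band_seq N m n a k.
rewrite -(sum_ord_reflect N (fun l => b ((p + (N - l)) %% N)%N * c l) p).
transitivity (\sum_(k < N) band_seq N m n a k * c ((p + (N - k)) %% N)%N).
  rewrite (sum_band_seq (fun k => c ((p + (N - k)) %% N)%N)).
  apply: eq_bigr => l _; congr (_ * c _); apply/esym/modn_addB.
    by rewrite ltnW // ltn_mod.
  have lt_l := ltn_ord l; rewrite modnDmr -[RHS]modnDr.
  by congr (_ %% _)%N; rewrite /p; lia.
apply: eq_bigr => k _; congr (band_seq _ _ _ _ _ * _).
rewrite -[LHS](modn_small (ltn_ord k)); apply/esym/modn_addB.
  by rewrite ltnW // ltn_mod.
by rewrite modnDmr addnCA subnKC 1?ltnW // modnDr.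
Qed.

End Band.

(** * Tensor trains and the ranks of unfoldings *)

Section DependentSnoc.
Variables (n : nat) (d : nat -> nat).
Implicit Types (f : {dffun forall k : 'I_n, 'I_(d k)}) (b : 'I_(d n)).
Implicit Type g : {dffun forall k : 'I_n.+1, 'I_(d k)}.

Fact dsnoc_subproof f b (k : 'I_n.+1) :
  ((if insub (k : nat) is Some j then f j : nat else b) < d k)%N.
Proof.
case: insubP => [j _ <- //|]; rewrite -leqNgt => le_nk.
suff -> : k = n :> nat by [].
by have := ltn_ord k; lia.
Qed.

Definition dsnoc f b : {dffun forall k : 'I_n.+1, 'I_(d k)} :=
  [ffun k => Ordinal (dsnoc_subproof f b k)].

(** The entries live in the distinct types ['I_(d k)] and ['I_(d j)], so they are compared as
    natural numbers. *)
Lemma dsnoc_widen f b (k : 'I_n.+1) (j : 'I_n) :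
  k = j :> nat -> dsnoc f b k = f j :> nat.
Proof. by move=> eq_kj; rewrite ffunE /= eq_kj valK. Qed.

Lemma dsnoc_max f b (k : 'I_n.+1) : k = n :> nat -> dsnoc f b k = b :> nat.
Proof. by move=> eq_kn; rewrite ffunE /= insubF // eq_kn ltnn. Qed.

Lemma big_dffun_recr (V : nmodType)
    (F : {dffun forall k : 'I_n.+1, 'I_(d k)} -> V) :
  \sum_g F g = \sum_f \sum_b F (dsnoc f b).
Proof.
rewrite pair_bigA /= (reindex (fun p => dsnoc p.1 p.2)) //=.
pose restr g : {dffun forall k : 'I_n, 'I_(d k)} :=
  [ffun k : 'I_n => g (widen_ord (leqnSn n) k)].
exists (fun g => (restr g, g ord_max)) => [[f b] _|g _] /=.
  congr pair; last exact/val_inj/dsnoc_max.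
  by apply/ffunP => k; apply: val_inj; rewrite ffunE; apply: dsnoc_widen.
apply/ffunP => k; apply: val_inj => /=.
have [lt_kn|le_nk] := ltnP k n.
  rewrite (@dsnoc_widen _ _ _ (Ordinal lt_kn)) // ffunE.
  by congr (nat_of_ord (g _)); apply: val_inj.
have eq_k : k = ord_max by apply: val_inj; have := ltn_ord k; rewrite /=; lia.
by rewrite {}eq_k in le_nk *; rewrite dsnoc_max.
Qed.

End DependentSnoc.

(** * Matrix products along a train *)

Section Train.
Variables (F : comNzRingType) (d : nat -> nat).
Implicit Type M : forall k, 'M[F]_(d k, d k.+1).

(** The vector of ones sums over the outer index; when that index ranges over a singleton, it is the
    scalar 1. *)
Fixpoint train_row M k : 'rV[F]_(d k) :=
  if k is k'.+1 then train_row M k' *m M k' else const_mx 1.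

Fixpoint train_col M s k : 'cV[F]_(d k) :=
  if s is s'.+1 then M k *m train_col M s' k.+1 else const_mx 1.

Lemma eq_train_row M1 M2 k : (forall j, (j < k)%N -> M1 j = M2 j) ->
  train_row M1 k = train_row M2 k.
Proof.
elim: k => //= k IHk eqM; rewrite eqM // IHk // => j lt_jk.
by apply: eqM; rewrite ltnW.
Qed.

Lemma eq_train_col M1 M2 s k : (forall j, (k <= j)%N -> M1 j = M2 j) ->
  train_col M1 s k = train_col M2 s k.
Proof.
elim: s k => //= s IHs k eqM; rewrite eqM // IHs // => j lt_kj.
by apply: eqM; rewrite ltnW.
Qed.

Lemma train_row_col M s k n : n = (k + s)%N ->
  train_row M n *m (const_mx 1 : 'cV_(d n)) = train_row M k *m train_col M s k.
Proof.
elim: s k => [|s IHs] k; first by rewrite addn0 => ->.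
by rewrite -addSnnS => /IHs -> /=; rewrite mulmxA.
Qed.

(** The boundary vector [h] is arbitrary so that the induction can peel off the last index and
    absorb the last matrix into [h]. *)
Lemma sum_train M n (h : 'cV[F]_(d n)) :
  \sum_(alpha : {dffun forall k : 'I_n.+1, 'I_(d k)})
    (\prod_(k < n) M k (alpha (widen_ord (leqnSn n) k)) (alpha (lift ord0 k)))
      * h (alpha ord_max) 0 =
  (train_row M n *m h) 0 0.
Proof.
elim: n h => [|n IHn] h; rewrite big_dffun_recr.
  pose f0 : {dffun forall k : 'I_0, 'I_(d k)} :=
    [ffun k : 'I_0 => match notF (ltn_ord k) with end].
  rewrite (big_pred1 f0) => [|f]; last first.
    by apply/esym/eqP/ffunP => -[].
  rewrite mxE; apply: eq_bigr => b _; rewrite big_ord0 mxE; congr (_ * h _ _).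
  exact/val_inj/dsnoc_max.
rewrite /= -mulmxA -IHn; apply: eq_bigr => f _.
rewrite mxE big_distrr /=; apply: eq_bigr => b _.
rewrite big_ord_recr /= -mulrA; congr (_ * (_ * _)).
- apply: eq_bigr => k _.
  by congr (M _ _ _); apply: val_inj; apply: dsnoc_widen.
- by congr (M _ _ _); apply: val_inj; [apply: dsnoc_widen | apply: dsnoc_max].
- by congr (h _ _); apply/val_inj/dsnoc_max.
Qed.

End Train.

(** * Unfoldings and minimal trains *)

Section Unfolding.
Variables (X : finType) (L : nat).
Local Notation index := {ffun 'I_L -> X}.
Implicit Types x y : index.

Definition splice k y x : index :=
  [ffun l : 'I_L => if (l < k)%N then y l else x l].

Variable F : fieldType.
Implicit Type T : index -> F.

(* Rows and columns range over complete multi-indices, so this is the k-th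
   unfolding matrix with its rows and columns repeated. *)
Definition unfolding T k : 'M[F]_#|{: index}| :=
  \matrix_(y, x) T (splice k (enum_val y) (enum_val x)).

(** Made total in [k] to fit the train lemmas; the value 0 past the last position never enters
    [train_value]. *)
Definition slice (d : nat -> nat)
    (G : forall k, X -> 'M[F]_(d k, d k.+1)) x k :=
  if insub k is Some j then G k (x j) else 0.

Definition train_value (d : nat -> nat)
    (G : forall k, X -> 'M[F]_(d k, d k.+1)) x : F :=
  (train_row (slice G x) L *m (const_mx 1 : 'cV_(d L))) 0 0.

(** Cutting the train at bond k factors the unfolding through dimension [d k]: the left product sees
    only the positions before k, the right one only the others. *)
Lemma rank_unfolding_le d (G : forall k, X -> 'M[F]_(d k, d k.+1)) T k :
  (k <= L)%N -> (forall x, T x = train_value G x) ->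
  (\rank (unfolding T k) <= d k)%N.
Proof.
move=> le_kL TE.
pose P := \matrix_(y < #|{: index}|) train_row (slice G (enum_val y)) k.
pose Q := \matrix_(a < d k, x < #|{: index}|)
            train_col (slice G (enum_val x)) (L - k) k a 0.
suff -> : unfolding T k = P *m Q by apply: mulmx_max_rank.
apply/matrixP => y x; rewrite !mxE TE /train_value.
rewrite (@train_row_col _ _ _ (L - k) k) ?subnKC // mxE.
apply: eq_bigr => b _; rewrite !mxE; congr (_ * _).
  congr (fun_of_matrix _ _ _); apply: eq_train_row => j lt_jk.
  by rewrite /slice; case: insubP => // i _ ij; rewrite ffunE ij lt_jk.
congr (fun_of_matrix _ _ _); apply: eq_train_col => j le_kj.
by rewrite /slice; case: insubP => // i _ ij; rewrite ffunE ij ltnNge le_kj.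
Qed.

(** Strictly inside, this is a full-rank factorization with [b] a basis of the row space. At the
    ends the size is 1 even for a zero tensor, and the outer factor is all ones. The sigma type lets
    the factors be chosen as functions of [k]. *)
Lemma unfolding_factor T k (e : nat) : (0 < L)%N -> index ->
  e = (if (0 < k < L)%N then \rank (unfolding T k) else 1%N) ->
  {D : 'M[F]_(_, e) & {b : 'M[F]_(e, _) & {C : 'M[F]_(e, _) |
    [/\ unfolding T k = D *m b, (k < L)%N -> b = C *m unfolding T k,
        k = 0%N -> D = const_mx 1 & (L <= k)%N -> b = const_mx 1]}}}.
Proof.
move=> L_gt0 x0 ->; case: ifP => [/andP[k_gt0 lt_kL]|].
  exists (col_base (unfolding T k)), (row_base (unfolding T k)).
  exists (row_base (unfolding T k) *m pinvmx (unfolding T k)); split=> [|_||].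
  - by rewrite mulmx_base.
  - by rewrite mulmxKpV // eq_row_base.
  - by move=> k0; rewrite k0 in k_gt0.
  - by rewrite leqNgt lt_kL.
have [->|k_neq0] := eqVneq k 0%N => k_out; last first.
  have le_Lk : (L <= k)%N by lia.
  exists (\col_y T (enum_val y)), (const_mx 1), 0; split=> [|||//].
  - apply/matrixP => y x; rewrite !mxE big_ord1 !mxE mulr1; congr T.
    by apply/ffunP => l; rewrite ffunE (leq_trans (ltn_ord l)).
  - by rewrite ltnNge le_Lk.
  - by move/eqP: k_neq0.
have unf0 (p q : 'I_#|{: index}|) : unfolding T 0 p q = T (enum_val q).
  by rewrite mxE; congr T; apply/ffunP => l; rewrite ffunE.
(* Every row of the 0-th unfolding is the whole tensor, so [C] just selects the row of [x0]. *)
exists (const_mx 1), (\row_x T (enum_val x)), (delta_mx 0 (enum_rank x0)).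
split=> [|_|//|]; last by rewrite leqn0 => /eqP L0; rewrite L0 in L_gt0.
- by apply/matrixP => y x; rewrite unf0 !mxE big_ord1 !mxE mul1r.
- by rewrite -rowE; apply/rowP => x; rewrite [RHS]mxE unf0 mxE.
Qed.

Definition update k (a : X) x : index :=
  [ffun l : 'I_L => if l == k :> nat then a else x l].

(** Links consecutive unfoldings: entry (y, x) of the k-th one stands in the same column of the next
    one, in the row [update k (x k) y]. *)
Lemma splice_update (k : 'I_L) y x :
  splice k.+1 (update k (x k) y) x = splice k y x.
Proof.
apply/ffunP => l; rewrite !ffunE ltnS leq_eqVlt.
by case: eqP => [/val_inj->|_] /=; rewrite ?ltnn.
Qed.

(* The k-th core expresses the slices of a basis of the k-th row space in the
   basis of the (k+1)-st one. *)
Lemma train_exists T (d : nat -> nat) : (0 < L)%N -> index ->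
  (forall k, d k = if (0 < k < L)%N then \rank (unfolding T k) else 1%N) ->
  exists G : forall k, X -> 'M[F]_(d k, d k.+1),
    forall x, T x = train_value G x.
Proof.
move=> L_gt0 x0 dE.
pose fac k := @unfolding_factor T k (d k) L_gt0 x0 (dE k).
pose D k := projT1 (fac k); pose b k := projT1 (projT2 (fac k)).
pose C k := proj1_sig (projT2 (projT2 (fac k))).
have facE k : [/\ unfolding T k = D k *m b k,
    (k < L)%N -> b k = C k *m unfolding T k,
    k = 0%N -> D k = const_mx 1 & (L <= k)%N -> b k = const_mx 1].
  exact: proj2_sig (projT2 (projT2 (fac k))).
pose up k a (y : 'I_#|{: index}|) : 'I_#|{: index}| :=
  enum_rank (update k a (enum_val y)).
pose G k a := C k *m rowsub (up k a) (D k.+1).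
exists G => x; pose p := enum_rank x.
have step (k : 'I_L) : G k (x k) *m col p (b k.+1) = col p (b k).
  have [_ -> // _ _] := facE k; have [UE _ _ _] := facE k.+1.
  rewrite /G [RHS]colE -!mulmxA -colE; congr (_ *m _).
  apply/matrixP => y q; rewrite !mxE.
  transitivity ((D k.+1 *m b k.+1) (up k (x k) y) p).
    by rewrite !mxE; apply: eq_bigr => c _; rewrite !mxE.
  by rewrite -UE mxE !enum_rankK splice_update.
(* The product telescopes. At [L] it is [train_value G x] because [b L] is all ones; at 0 it is an
   entry of [unfolding T 0], namely [T x]. *)
have chain k : (k <= L)%N ->
    train_row (slice G x) k *m col p (b k) =
    train_row (slice G x) 0 *m col p (b 0%N).
  elim: k => // k IHk lt_kL; rewrite -IHk 1?ltnW //= -mulmxA; congr (_ *m _).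
  by rewrite /slice insubT (step (Ordinal lt_kL)).
have [UE _ D0 _] := facE 0%N; have [_ _ _ bL] := facE L.
have := chain L (leqnn L); rewrite bL // /train_value.
have -> : col p (const_mx 1) = const_mx 1 :> 'cV[F]_(d L).
  by apply/matrixP => c q; rewrite !mxE.
move=> ->; transitivity (unfolding T 0 p p).
  by rewrite mxE enum_rankK; congr T; apply/ffunP => l; rewrite ffunE.
by rewrite UE D0 // !mxE; apply: eq_bigr => c _; rewrite !mxE.
Qed.

End Unfolding.

(** * QTT representations as trains over pairs of bits *)

Section QTT.
Variables (F : fieldType) (L : nat) (B : 'M[F]_(2 ^ L)).
Local Notation index := {ffun 'I_L -> 'I_2 * 'I_2}.

Definition qtt_tensor (x : index) : F :=
  B (bits_index (fun l => (x l).1)) (bits_index (fun l => (x l).2)).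

Lemma eq_bits_index (i j : 'I_L -> 'I_2) :
  i =1 j -> bits_index i = bits_index j.
Proof.
by move=> eq_ij; apply/val_inj/eq_bigr => k _; rewrite eq_ij.
Qed.

Lemma qtt_dim_out (r : L.-1.-tuple nat) k : (0 < L)%N -> (L <= k)%N ->
  qtt_dim r k = 1%N.
Proof.
by move=> L_gt0 le_Lk; rewrite /qtt_dim nth_default //= size_tuple prednK.
Qed.

Lemma qtt_dim_tnth (r : L.-1.-tuple nat) (k : 'I_L.-1) :
  qtt_dim r k.+1 = tnth r k.
Proof. by rewrite (tnth_nth 1%N). Qed.

Lemma has_qtt_reprP (r : L.-1.-tuple nat) : (0 < L)%N ->
  has_qtt_repr B r <->
  exists G : forall k, 'I_2 * 'I_2 -> 'M[F]_(qtt_dim r k, qtt_dim r k.+1),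
    forall x, qtt_tensor x = train_value G x.
Proof.
move=> L_gt0.
have valueE (G : forall k, 'I_2 * 'I_2 ->
      'M[F]_(qtt_dim r k, qtt_dim r k.+1)) x :
    train_value G x =
    \sum_(alpha : {dffun forall k : 'I_L.+1, 'I_(qtt_dim r k)})
      \prod_(k < L) G k (x k) (alpha (widen_ord (leqnSn L) k))
                              (alpha (lift ord0 k)).
  rewrite /train_value -sum_train; apply: eq_bigr => alpha _; rewrite mxE mulr1.
  by apply: eq_bigr => k _; rewrite /slice valK.
split=> [[G GE]|[G GE]].
  (* Matching on [idP] supplies the proof of [k < L] needed to call [G], and extends the cores by 0
     to all [k]. *)
  pose G' k (a : 'I_2 * 'I_2) : 'M[F]_(qtt_dim r k, qtt_dim r k.+1) :=
    match @idP (k < L)%N with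
    | ReflectT lt_kL => \matrix_(s, t) G (Ordinal lt_kL) s a.1 a.2 t
    | ReflectF _ => 0
    end.
  have G'E (k : 'I_L) a s t : G' k a s t = G k s a.1 a.2 t.
    case: k s t => k lt_kL s t; rewrite /G' /=.
    case: {-}_ / idP => [lt_kL'|//]; rewrite mxE.
    by rewrite (bool_irrelevance lt_kL lt_kL').
  exists G' => x; rewrite /qtt_tensor GE valueE; apply: eq_bigr => alpha _.
  by apply: eq_bigr => k _; rewrite G'E.
exists (fun k s i j t => G k (i, j) s t) => i j.
pose x : index := [ffun k => (i k, j k)].
have -> : B (bits_index i) (bits_index j) = qtt_tensor x.
  by congr (B _ _); apply: eq_bits_index => k; rewrite ffunE.
rewrite GE valueE; apply: eq_bigr => alpha _.
by apply: eq_bigr => k _; rewrite ffunE.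
Qed.

(** The unfolding ranks bound every representation from below, and one train attains all of them
    simultaneously. *)
Lemma qtt_ranks_exist : (0 < L)%N ->
  is_qtt_ranks B [tuple \rank (unfolding qtt_tensor k.+1) | k < L.-1].
Proof.
move=> L_gt0; set r := [tuple _ | k < _]; split.
  apply/has_qtt_reprP => //; apply: train_exists => // [|k].
    exact: [ffun=> (ord0, ord0)].
  case: k => [//|k]; rewrite /= -[(k.+1 < L)%N]ltn_predRL.
  case: ifP => [lt_k|/negbT]; last first.
    by rewrite -leqNgt => le_k; apply: (qtt_dim_out r (k := k.+1)) => //; lia.
  by rewrite (qtt_dim_tnth r (Ordinal lt_k)) tnth_mktuple.
move=> r' /(has_qtt_reprP _ L_gt0)[G GE] k; rewrite tnth_mktuple -qtt_dim_tnth.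
by apply: rank_unfolding_le GE; have := ltn_ord k; lia.
Qed.

End QTT.

(** * Unfoldings of circulants with recurrent entries *)

(** Since [b 0] is invertible, each term is determined by the preceding q ones. The rows [W] are
    chosen before [x], so they serve all solutions at once. *)
Lemma recurrence_span (F : fieldType) q (b : nat -> F) m : b 0%N != 0 ->
  exists W : nat -> 'rV[F]_q, forall x : nat -> F,
    (forall s, (q <= s < m)%N -> \sum_(l < q.+1) b l * x (s - l)%N = 0) ->
    forall s, (s < m)%N -> x s = \sum_(t < q) W s 0 t * x t.
Proof.
move=> b0; elim: m => [|m [W WE]]; first by exists (fun=> 0).
exists (fun s => if s != m then W s else
  if (m < q)%N then \row_t (t == m :> nat)%:R
  else - (b 0%N)^-1 *: \sum_(l < q) b l.+1 *: W (m - l.+1)%N) => x xE s.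
have {}WE := WE x (fun s s_in => xE s ltac:(lia)).
rewrite ltnS leq_eqVlt; case: eqVneq => [->|_] /= lt_sm; last exact: WE.
have [lt_mq|le_qm] := ltnP m q.
  rewrite (bigD1 (Ordinal lt_mq)) //= mxE eqxx mul1r big1 ?addr0 // => t.
  by rewrite -val_eqE mxE /= => /negPf->; rewrite mul0r.
have /eqP := xE m ltac:(lia); rewrite big_ord_recl subn0 addr_eq0 => /eqP xm.
rewrite -[x m](mulKf b0) {}xm mulrN -mulNr.
under [RHS]eq_bigr => t _ do rewrite mxE summxE -mulrA mulr_suml.
rewrite -mulr_sumr exchange_big; congr (_ * _); apply: eq_bigr => l _ /=.
rewrite WE; last by have := ltn_ord l; rewrite /bump; lia.
by rewrite mulr_sumr; apply: eq_bigr => t _; rewrite mxE mulrA.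
Qed.

Section BitSplit.
Variable L : nat.
Implicit Type i : 'I_L -> 'I_2.

Definition high_part k i := (\sum_(l < L | l < k) 2 ^ (L - l.+1) * i l)%N.

Definition low_part k i := (\sum_(l < L | ~~ (l < k)) 2 ^ (L - l.+1) * i l)%N.

Lemma bits_index_split k i :
  bits_index i = (high_part k i + low_part k i)%N :> nat.
Proof. by rewrite /= (bigID (fun l : 'I_L => (l < k)%N)). Qed.

Lemma dvdn_high_part k i : (2 ^ (L - k) %| high_part k i)%N.
Proof.
by apply: dvdn_sum => l lt_lk; rewrite dvdn_mulr // dvdn_exp2l //; lia.
Qed.

(** A multiple of 2^(L-k) below 2^L is at most 2^L - 2^(L-k). *)
Lemma high_part_le k i : (k <= L)%N -> (high_part k i + 2 ^ (L - k) <= 2 ^ L)%N.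
Proof.
move=> le_kL; have := ltn_ord (bits_index i); rewrite (bits_index_split k).
have /dvdnP[q ->] := dvdn_high_part k i.
have -> : (2 ^ L = 2 ^ k * 2 ^ (L - k))%N by rewrite -expnD subnKC.
rewrite -mulSnr leq_pmul2r ?expn_gt0 // => /(leq_ltn_trans (leq_addr _ _)).
by rewrite ltn_pmul2r ?expn_gt0.
Qed.

End BitSplit.

Lemma low_part_lt L k (i : 'I_L -> 'I_2) : (low_part k i < 2 ^ (L - k))%N.
Proof.
elim: L k i => [|L IHL] k i; first by rewrite /low_part big_ord0 expn_gt0.
case: k => [|k]; first by rewrite subn0; apply: bits_index_subproof.
rewrite /low_part big_mkcond big_ord_recl /= add0n subSS -big_mkcond.
exact: (IHL k (fun l => i (lift ord0 l))).
Qed.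

(* The recurrence breaks only across the term [c 0]: it is the centre of the
   window of [2 * M - 1] consecutive terms when [h1 = h2], and lies outside of
   the window otherwise. *)
Lemma cyclic_window_span (F : fieldType) N M m n q (b c : nat -> F) :
  (2 <= m)%N -> (m + n = 1 + q)%N -> (m + n <= N)%N -> b 0%N != 0 ->
  (forall u, ((u + (N - n)) %% N != 0)%N ->
     \sum_(l < 1 + q) b l * c ((u + (N - l)) %% N)%N = 0) ->
  exists W : nat -> 'rV[F]_q, forall h1 h2 l1 l2 : nat,
    (M %| h1)%N -> (M %| h2)%N -> (h1 + M <= N)%N -> (h2 + M <= N)%N ->
    (l1 < M)%N -> (l2 < M)%N ->
    c ((h1 + l1 + (N - (h2 + l2))) %% N)%N =
    if h1 == h2 then c ((l1 + (N - l2)) %% N)%N else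
    \sum_(t < q) c ((h1 + (N - h2 - (M - 1)) + t) %% N)%N *
                 W (l1 + (M - 1) - l2)%N 0 t.
Proof.
move=> m_ge2 mnE le_mnN b0 cE; have [W WE] := recurrence_span q (2 * M - 1) b0.
exists W => h1 h2 l1 l2 dvd1 dvd2 le1 le2 lt1 lt2.
have [<-|neq_h] := eqVneq h1 h2; first by congr (c (_ %% _)%N); lia.
(* Distinct multiples of [M] are at least [M] apart. *)
have h_far : (h1 + M <= h2)%N || (h2 + M <= h1)%N.
  case/dvdnP: dvd1 neq_h => p1 ->; case/dvdnP: dvd2 => p2 ->.
  rewrite -!mulSnr !leq_mul2r.
  by case: (ltngtP p1 p2) => // [_|_|->]; rewrite ?orbT ?eqxx.
(* The window starts at the smallest possible difference, with l1 = 0 and l2 = M - 1. *)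
pose x t := c ((h1 + (N - h2 - (M - 1)) + t) %% N)%N.
transitivity (x (l1 + (M - 1) - l2)%N); first by congr (c (_ %% _)%N); lia.
rewrite (WE x); [by apply: eq_bigr => t _; rewrite mulrC| |lia].
move=> s s_in; pose u := (h1 + (N - h2 - (M - 1)) + s)%N; rewrite -[RHS](cE u).
  apply: eq_bigr => -[l lt_l] _ /=; congr (_ * c _).
  apply/esym/modn_addB; first by lia.
  by congr (_ %% _)%N; rewrite /u; lia.
(* As s >= q >= n, u - n lies strictly between 0 and N in the first case and strictly between N and
   2N in the second, so it is not 0 modulo N. *)
case/orP: h_far => far.
  have -> : (u + (N - n) = u - n + N)%N by rewrite /u; lia.
  by rewrite modnDr modn_small /u; lia.
have -> : (u + (N - n) = u - n - N + N + N)%N by rewrite /u; lia.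
by rewrite !modnDr modn_small /u; lia.
Qed.

Lemma rank_circ_unfolding (F : fieldType) L k m n (b c : nat -> F) :
  (k <= L)%N -> (2 <= m)%N -> (m + n <= 2 ^ L)%N -> b 0%N != 0 ->
  (forall u, ((u + (2 ^ L - n)) %% 2 ^ L != 0)%N ->
     \sum_(l < m + n) b l * c ((u + (2 ^ L - l)) %% 2 ^ L)%N = 0) ->
  (\rank (unfolding (qtt_tensor (circ (2 ^ L) c)) k) <= m + n)%N.
Proof.
move=> le_kL m_ge2 le_mnN b0 cE.
have [q mnE] : {q | (m + n = 1 + q)%N} by exists (m + n).-1; lia.
rewrite mnE in cE *.
have [W WE] := cyclic_window_span (2 ^ (L - k)) m_ge2 mnE le_mnN b0 cE.
set M := (2 ^ (L - k))%N in WE; set N := (2 ^ L)%N in cE WE *.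
set K := #|_|.
pose hi (s : 'I_2 * 'I_2 -> 'I_2) (y : 'I_K) :=
  high_part k (fun l => s (enum_val y l)).
pose lo (s : 'I_2 * 'I_2 -> 'I_2) (y : 'I_K) :=
  low_part k (fun l => s (enum_val y l)).
pose w y := \row_(t < q) c ((hi fst y + (N - hi snd y - (M - 1)) + t) %% N)%N.
(* One coordinate is reserved for the single row shared by all equal high parts; the other q hold
   the initial terms of the window. *)
pose P : 'M[F]_(K, 1 + q) := \matrix_y
  (if hi fst y == hi snd y then row_mx 1 0 else row_mx 0 (w y)).
pose Q : 'M[F]_(1 + q, K) :=
  col_mx (\row_x c ((lo fst x + (N - lo snd x)) %% N)%N)
         (\matrix_(t, x) W (lo fst x + (M - 1) - lo snd x)%N 0 t).
suff -> : unfolding (qtt_tensor (circ N c)) k = P *m Q by apply: mulmx_max_rank.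
apply/matrixP => y x; rewrite [LHS]mxE /qtt_tensor [LHS]mxE.
have spliceE s :
    bits_index (fun l => s (splice k (enum_val y) (enum_val x) l)) =
    (hi s y + lo s x)%N :> nat.
  rewrite (bits_index_split k); congr addn; apply: eq_bigr => l.
    by move=> lt_lk; rewrite ffunE lt_lk.
  by move=> /negPf ge_lk; rewrite ffunE ge_lk.
rewrite (spliceE fst) (spliceE snd) WE ?dvdn_high_part ?high_part_le
  ?low_part_lt //.
have -> : (P *m Q) y x = (row y P *m Q) 0 x by rewrite -row_mul [RHS]mxE.
rewrite rowK; case: ifP => _; rewrite mul_row_col mul0mx ?addr0 ?add0r.
  by rewrite mul1mx mxE.
by rewrite mxE; apply: eq_bigr => t _; rewrite !mxE.
Qed.

Theorem corollary3p3 (R : realType) (L m n : nat) (a : int -> R[i])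
    (hL : (0 < L)%N) (hm : (2 <= m)%N) (hmn : (m + n <= 2 ^ L)%N)
    (ham : a (m%:Z - 1) != 0) (han : a (- n%:Z) != 0)
    (hg : forall z : R[i], `|z| = 1 -> ~~ root (band_poly m n a) z) :
  let A : 'M[R[i]]_(2 ^ L) := circ (2 ^ L) (band_seq (2 ^ L) m n a) in
  A \in unitmx /\
  exists r : L.-1.-tuple nat,
    is_qtt_ranks (invmx A) r /\ forall k : 'I_L.-1, (tnth r k <= m + n)%N.
Proof.
move=> A; have N_gt0 : (0 < 2 ^ L)%N by rewrite expn_gt0.
have uA : A \in unitmx.
  apply: circ_unitmx => [|z zN1]; first by rewrite pnatr_eq0 -lt0n.
  have z1 : `|z| = 1.
    by apply/eqP; rewrite -(pexpr_eq1 N_gt0) // -normrX zN1 normr1.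
  rewrite horner_band_seq // mulf_neq0 ?expf_neq0 //; first exact: hg.
  by rewrite -normr_gt0 z1.
split=> //; have [c -> cE] := invmx_circ N_gt0 uA.
eexists; split=> [|k]; first exact: qtt_ranks_exist.
rewrite tnth_mktuple; have lt_k := ltn_ord k.
apply: (@rank_circ_unfolding _ _ _ _ _ (fun l => a (l%:Z - n%:Z))) => //.
- by lia.
- by rewrite sub0r.
by move=> u /negPf u_n0; rewrite (band_recurrence hmn N_gt0 cE) u_n0.
Qed.
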